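(* For every PLTL formula $A$: $A$ is satisfiable if and only if $\tau_0[A]$ is satisfiable.
   Context: PLTL formulae are built from proposition symbols, $\mathbf{true}$, $\mathbf{false}$, $\neg,\vee,\wedge,\Rightarrow$ and temporal operators $\bigcirc$ (next), $\Diamond$ (sometime), $\Box$ (always), $\mathcal{U}$ (until), $\mathcal{W}$ (unless). A model is an infinite sequence $\sigma=s_0,s_1,\dots$ of sets of proposition symbols; $(\sigma,i)\models p$ iff $p\in s_i$; Boolean connectives as usual; $\bigcirc A$ holds at $i$ iff $A$ at $i+1$; $\Diamond A$ at $i$ iff $A$ at some $k\ge i$; $\Box A$ at $i$ iff $A$ at all $j\ge i$; $A\,\mathcal{U}\,B$ at $i$ iff $B$ at some $k\ge i$ and $A$ at all $j$, $i\le j<k$; $A\,\mathcal{W}\,B$ iff $A\,\mathcal{U}\,B$ or $\Box A$. The nullary connective $\mathbf{start}$ holds exactly at index $0$. $A$ is satisfiable if $(\sigma,0)\models A$ for some $\sigma$. A literal is a proposition symbol or its negation. A PLTL-clause is a formula $\mathbf{start}\Rightarrow\bigvee_c l_c$, $\bigwedge_a k_a\Rightarrow\bigcirc\bigvee_d l_d$ or $\bigwedge_b k_b\Rightarrow\Diamond l$ with all $k,l$ literals. The translation: $\tau_0[A]=\Box(\mathbf{start}\Rightarrow y)\wedge\tau_1[\Box(y\Rightarrow A)]$ with $y$ a fresh proposition symbol, where $\tau_1$, applied to formulae $\Box(x\Rightarrow W)$ ($x$ a proposition symbol), is computed by applying the following rewrite rules repeatedly until the result is a conjunction of formulae $\Box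 A_i$ with each $A_i$ a PLTL-clause (write $\tau_1[x\Rightarrow A]$ for $\tau_1[\Box(x\Rightarrow A)]$; $y,z,v$ denote proposition symbols new at each application; $l,m,l_i$ literals; $\neg\mathbf{true}$, $\neg\mathbf{false}$ are rewritten to $\mathbf{false}$, $\mathbf{true}$). (1) $x\Rightarrow(A\wedge B)\mapsto\tau_1[x\Rightarrow A]\wedge\tau_1[x\Rightarrow B]$; $x\Rightarrow(A\Rightarrow B)\mapsto\tau_1[x\Rightarrow\neg A\vee B]$; $x\Rightarrow\neg(A\wedge B)\mapsto\tau_1[x\Rightarrow\neg A\vee\neg B]$; $x\Rightarrow\neg(A\Rightarrow B)\mapsto\tau_1[x\Rightarrow A]\wedge\tau_1[x\Rightarrow\neg B]$; $x\Rightarrow\neg(A\vee B)\mapsto\tau_1[x\Rightarrow\neg A]\wedge\tau_1[x\Rightarrow\neg B]$. (2) $x\Rightarrow\bigcirc A\mapsto\Box(x\Rightarrow\bigcirc y)\wedge\tau_1[y\Rightarrow A]$ if $A$ is neither a literal nor a disjunction of literals; $x\Rightarrow\neg\bigcirc A\mapsto\Box(x\Rightarrow\bigcirc y)\wedge\tau_1[y\Rightarrow\neg A]$; $x\Rightarrow\Box A\mapsto\tau_1[x\Rightarrow\Box y]\wedge\tau_1[y\Rightarrow A]$ if $A$ is not a literal; $x\Rightarrow\neg\Box A\mapsto\Box(x\Rightarrow\Diamond y)\wedge\tau_1[y\Rightarrow\neg A]$; $x\Rightarrow\Diamond A\mapsto\Box(x\Rightarrow\Diamond y)\wedge\tau_1[y\Rightarrow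 A]$ if $A$ is not a literal; $x\Rightarrow\neg\Diamond A\mapsto\tau_1[x\Rightarrow\Box y]\wedge\tau_1[y\Rightarrow\neg A]$; $x\Rightarrow A\,\mathcal{U}\,B\mapsto\tau_1[x\Rightarrow y\,\mathcal{U}\,B]\wedge\tau_1[y\Rightarrow A]$ if $A$ is not a literal, and $\mapsto\tau_1[x\Rightarrow A\,\mathcal{U}\,y]\wedge\tau_1[y\Rightarrow B]$ if $B$ is not a literal; the same two rules with $\mathcal{W}$ in place of $\mathcal{U}$; $x\Rightarrow\neg(A\,\mathcal{U}\,B)\mapsto\tau_1[x\Rightarrow y\,\mathcal{W}\,v]\wedge\tau_1[y\Rightarrow\neg B]\wedge\tau_1[v\Rightarrow(y\wedge z)]\wedge\tau_1[z\Rightarrow\neg A]$; $x\Rightarrow\neg(A\,\mathcal{W}\,B)\mapsto\tau_1[x\Rightarrow y\,\mathcal{U}\,v]\wedge\tau_1[y\Rightarrow\neg B]\wedge\tau_1[v\Rightarrow(y\wedge z)]\wedge\tau_1[z\Rightarrow\neg A]$. (3) $x\Rightarrow\Box l\mapsto\tau_1[x\Rightarrow l]\wedge\tau_1[x\Rightarrow y]\wedge\Box(y\Rightarrow\bigcirc l)\wedge\Box(y\Rightarrow\bigcirc y)$; $x\Rightarrow l\,\mathcal{U}\,m\mapsto\Box(x\Rightarrow\Diamond m)\wedge\tau_1[x\Rightarrow l\vee m]\wedge\tau_1[x\Rightarrow y\vee m]\wedge\Box(y\Rightarrow\bigcirc(l\vee m))\wedge\Box(y\Rightarrow\bigcirc(y\vee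 m))$; $x\Rightarrow l\,\mathcal{W}\,m\mapsto$ the same without the conjunct $\Box(x\Rightarrow\Diamond m)$. (4) $x\Rightarrow D\vee A\mapsto\tau_1[x\Rightarrow D\vee y]\wedge\tau_1[y\Rightarrow A]$, where $D$ is a disjunction and $A$ is neither a literal nor a disjunction of literals. (5) $x\Rightarrow D\mapsto\Box(\mathbf{start}\Rightarrow\neg x\vee D)\wedge\Box(\mathbf{true}\Rightarrow\bigcirc(\neg x\vee D))$ for $D$ a literal or disjunction of literals; $x\Rightarrow\mathbf{true}\mapsto\Box(\mathbf{start}\Rightarrow\mathbf{true})\wedge\Box(\mathbf{true}\Rightarrow\bigcirc\mathbf{true})$; $x\Rightarrow\mathbf{false}\mapsto\Box(\mathbf{start}\Rightarrow\neg x)\wedge\Box(\mathbf{true}\Rightarrow\bigcirc\neg x)$; $\tau_1[x\Rightarrow\Diamond l]=\Box(x\Rightarrow\Diamond l)$ and $\tau_1[x\Rightarrow\bigcirc(l_1\vee\dots\vee l_n)]=\Box(x\Rightarrow\bigcirc(l_1\vee\dots\vee l_n))$. $\tau_1[\cdot]$ and $\tau_0[\cdot]$ denote the final results.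
   Formalization: As listed, the rules leave τ0[¬¬p] undefined (no rule for x⇒¬¬A); here ¬¬A is also rewritten to A, rule (4) is read up to associativity and commutativity of ∨, and start⇒true and true⇒○true count as clauses. The claim is proved for every possible final result, and one exists. *)

(* Defs.v *)
From Stdlib Require Export Relation_Operators.
From mathcomp Require Export all_boot.

Set Implicit Arguments.
Unset Strict Implicit.
Unset Printing Implicit Defensive.

Definition psym := nat.

(* [Start] is not a PLTL connective: it is only used in the clauses produced by
   the translation; see [pltl]. *)
Inductive formula : Type :=
  | Var of psym
  | Top
  | Bot
  | Start
  | Neg of formula
  | Or of formula & formula
  | And of formula & formula
  | Imp of formula & formula
  | Next of formula
  | Sometime of formula
  | Always of formula
  | Until of formula & formula
  | Unless of formula & formula.

Declare Scope pltl_scope.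
Delimit Scope pltl_scope with pltl.
Bind Scope pltl_scope with formula.
Notation "A :/\: B" := (And A B)
  (at level 80, right associativity) : pltl_scope.
Notation "A :\/: B" := (Or A B)
  (at level 70, right associativity) : pltl_scope.
Notation "A ==>> B" := (Imp A B)
  (at level 75, right associativity) : pltl_scope.
Notation "x ~~> W" := (Always (Imp (Var x) W))
  (at level 75, no associativity) : pltl_scope.
Local Open Scope pltl_scope.

Fixpoint pltl (A : formula) : bool :=
  match A with
  | Var _ | Top | Bot => true
  | Start => false
  | Neg B | Next B | Sometime B | Always B => pltl B
  | Or B C | And B C | Imp B C | Until B C | Unless B C => pltl B && pltl C
  end.

Fixpoint syms (A : formula) : seq psym :=
  match A with
  | Var p => [:: p]
  | Top | Bot | Start => [::]
  | Neg B | Next B | Sometime B | Always B => syms B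
  | Or B C | And B C | Imp B C | Until B C | Unless B C => syms B ++ syms C
  end.

Definition model := nat -> psym -> Prop.

Fixpoint holds (s : model) (i : nat) (A : formula) : Prop :=
  match A with
  | Var p => s i p
  | Top => True
  | Bot => False
  | Start => i = 0
  | Neg B => ~ holds s i B
  | Or B C => holds s i B \/ holds s i C
  | And B C => holds s i B /\ holds s i C
  | Imp B C => holds s i B -> holds s i C
  | Next B => holds s i.+1 B
  | Sometime B => exists2 k, i <= k & holds s k B
  | Always B => forall j, i <= j -> holds s j B
  | Until B C => exists k, [/\ i <= k, holds s k C &
      forall j, i <= j < k -> holds s j B]
  | Unless B C =>
      (exists k, [/\ i <= k, holds s k C &
         forall j, i <= j < k -> holds s j B])
      \/ (forall j, i <= j -> holds s j B)
  end.

Definition satisfiable (A : formula) : Prop := exists s : model, holds s 0 A.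

Definition literal (A : formula) : bool :=
  match A with Var _ | Neg (Var _) => true | _ => false end.

(* Nonempty disjunctions of literals, single literals included. *)
Fixpoint lit_disj (A : formula) : bool :=
  match A with Or B C => lit_disj B && lit_disj C | _ => literal A end.

Fixpoint nonempty_lit_conj (A : formula) : bool :=
  match A with
  | And B C => nonempty_lit_conj B && nonempty_lit_conj C
  | _ => literal A
  end.

(* [Top] is the empty conjunction. *)
Definition lit_conj (A : formula) : bool :=
  match A with Top => true | _ => nonempty_lit_conj A end.

(* [Start ==>> Top] and [Top ==>> Next Top] are counted as (trivial) clauses,
   since the rule for [x ~~> Top] produces them as final results. *)
Definition clause (A : formula) : bool :=
  match A with
  | Start ==>> Top => true
  | Top ==>> Next Top => true
  | Start ==>> D => lit_disj D
  | K ==>> Next D => lit_conj K && lit_disj D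
  | K ==>> Sometime l => lit_conj K && literal l
  | _ => false
  end.

Fixpoint clausal (F : formula) : bool :=
  match F with
  | And G H => clausal G && clausal H
  | Always C => clause C
  | _ => false
  end.

(* Equality up to associativity and commutativity of the outermost
   disjunctions. *)
Inductive or_ac : formula -> formula -> Prop :=
  | or_ac_refl A : or_ac A A
  | or_ac_sym A B : or_ac A B -> or_ac B A
  | or_ac_trans A B C : or_ac A B -> or_ac B C -> or_ac A C
  | or_acC A B : or_ac (A :\/: B) (B :\/: A)
  | or_acA A B C : or_ac (A :\/: (B :\/: C)) ((A :\/: B) :\/: C)
  | or_ac_cong A A' B B' :
      or_ac A A' -> or_ac B B' -> or_ac (A :\/: B) (A' :\/: B').

(* One simplification of a negated constant or of a double negation, at any
   position. *)
Inductive neg_simp : formula -> formula -> Prop :=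
  | simp_negT : neg_simp (Neg Top) Bot
  | simp_negF : neg_simp (Neg Bot) Top
  | simp_negK A : neg_simp (Neg (Neg A)) A
  | simp_Neg A A' : neg_simp A A' -> neg_simp (Neg A) (Neg A')
  | simp_Next A A' : neg_simp A A' -> neg_simp (Next A) (Next A')
  | simp_Sometime A A' : neg_simp A A' -> neg_simp (Sometime A) (Sometime A')
  | simp_Always A A' : neg_simp A A' -> neg_simp (Always A) (Always A')
  | simp_Orl A A' B : neg_simp A A' -> neg_simp (Or A B) (Or A' B)
  | simp_Orr A B B' : neg_simp B B' -> neg_simp (Or A B) (Or A B')
  | simp_Andl A A' B : neg_simp A A' -> neg_simp (And A B) (And A' B)
  | simp_Andr A B B' : neg_simp B B' -> neg_simp (And A B) (And A B')
  | simp_Impl A A' B : neg_simp A A' -> neg_simp (Imp A B) (Imp A' B)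
  | simp_Impr A B B' : neg_simp B B' -> neg_simp (Imp A B) (Imp A B')
  | simp_Untill A A' B : neg_simp A A' -> neg_simp (Until A B) (Until A' B)
  | simp_Untilr A B B' : neg_simp B B' -> neg_simp (Until A B) (Until A B')
  | simp_Unlessl A A' B : neg_simp A A' -> neg_simp (Unless A B) (Unless A' B)
  | simp_Unlessr A B B' : neg_simp B B' -> neg_simp (Unless A B) (Unless A B').

Definition fresh (U ys : seq psym) : bool :=
  uniq ys && all [pred y | y \notin U] ys.

(* [rule U F G]: one rewrite rule turns F into G, the symbols it introduces
   being distinct and outside U. There is no marker for the conjuncts still to
   be translated: no rule has a clause as its left-hand side. *)
Inductive rule (U : seq psym) : formula -> formula -> Prop :=
  | rule_simp x A A' : neg_simp A A' -> rule U (x ~~> A) (x ~~> A')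
  | rule_And x A B :
      rule U (x ~~> And A B) ((x ~~> A) :/\: (x ~~> B))
  | rule_Imp x A B :
      rule U (x ~~> Imp A B) (x ~~> Neg A :\/: B)
  | rule_NegAnd x A B :
      rule U (x ~~> Neg (And A B)) (x ~~> Neg A :\/: Neg B)
  | rule_NegImp x A B :
      rule U (x ~~> Neg (Imp A B)) ((x ~~> A) :/\: (x ~~> Neg B))
  | rule_NegOr x A B :
      rule U (x ~~> Neg (Or A B)) ((x ~~> Neg A) :/\: (x ~~> Neg B))
  | rule_Next x A y : fresh U [:: y] -> ~~ lit_disj A ->
      rule U (x ~~> Next A) ((x ~~> Next (Var y)) :/\: (y ~~> A))
  | rule_NegNext x A y : fresh U [:: y] ->
      rule U (x ~~> Neg (Next A)) ((x ~~> Next (Var y)) :/\: (y ~~> Neg A))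
  | rule_Always x A y : fresh U [:: y] -> ~~ literal A ->
      rule U (x ~~> Always A) ((x ~~> Always (Var y)) :/\: (y ~~> A))
  | rule_NegAlways x A y : fresh U [:: y] ->
      rule U (x ~~> Neg (Always A))
        ((x ~~> Sometime (Var y)) :/\: (y ~~> Neg A))
  | rule_Sometime x A y : fresh U [:: y] -> ~~ literal A ->
      rule U (x ~~> Sometime A) ((x ~~> Sometime (Var y)) :/\: (y ~~> A))
  | rule_NegSometime x A y : fresh U [:: y] ->
      rule U (x ~~> Neg (Sometime A))
        ((x ~~> Always (Var y)) :/\: (y ~~> Neg A))
  | rule_Untill x A B y : fresh U [:: y] -> ~~ literal A ->
      rule U (x ~~> Until A B) ((x ~~> Until (Var y) B) :/\: (y ~~> A))
  | rule_Untilr x A B y : fresh U [:: y] -> ~~ literal B ->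
      rule U (x ~~> Until A B) ((x ~~> Until A (Var y)) :/\: (y ~~> B))
  | rule_Unlessl x A B y : fresh U [:: y] -> ~~ literal A ->
      rule U (x ~~> Unless A B) ((x ~~> Unless (Var y) B) :/\: (y ~~> A))
  | rule_Unlessr x A B y : fresh U [:: y] -> ~~ literal B ->
      rule U (x ~~> Unless A B) ((x ~~> Unless A (Var y)) :/\: (y ~~> B))
  | rule_NegUntil x A B y z v : fresh U [:: y; z; v] ->
      rule U (x ~~> Neg (Until A B))
        ((x ~~> Unless (Var y) (Var v)) :/\: (y ~~> Neg B)
         :/\: (v ~~> And (Var y) (Var z)) :/\: (z ~~> Neg A))
  | rule_NegUnless x A B y z v : fresh U [:: y; z; v] ->
      rule U (x ~~> Neg (Unless A B))
        ((x ~~> Until (Var y) (Var v)) :/\: (y ~~> Neg B)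
         :/\: (v ~~> And (Var y) (Var z)) :/\: (z ~~> Neg A))
  | rule_Always_lit x l y : fresh U [:: y] -> literal l ->
      rule U (x ~~> Always l)
        ((x ~~> l) :/\: (x ~~> Var y)
         :/\: (y ~~> Next l) :/\: (y ~~> Next (Var y)))
  | rule_Until_lit x l m y : fresh U [:: y] -> literal l -> literal m ->
      rule U (x ~~> Until l m)
        ((x ~~> Sometime m)
         :/\: (x ~~> l :\/: m) :/\: (x ~~> Var y :\/: m)
         :/\: (y ~~> Next (l :\/: m)) :/\: (y ~~> Next (Var y :\/: m)))
  | rule_Unless_lit x l m y : fresh U [:: y] -> literal l -> literal m ->
      rule U (x ~~> Unless l m)
        ((x ~~> l :\/: m) :/\: (x ~~> Var y :\/: m)
         :/\: (y ~~> Next (l :\/: m)) :/\: (y ~~> Next (Var y :\/: m)))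
  | rule_Or x W D A y :
      or_ac W (D :\/: A) -> fresh U [:: y] -> ~~ lit_disj A ->
      rule U (x ~~> W) ((x ~~> D :\/: Var y) :/\: (y ~~> A))
  | rule_lit_disj x D : lit_disj D ->
      rule U (x ~~> D)
        (Always (Start ==>> Neg (Var x) :\/: D)
         :/\: Always (Top ==>> Next (Neg (Var x) :\/: D)))
  | rule_Top x :
      rule U (x ~~> Top)
        (Always (Start ==>> Top) :/\: Always (Top ==>> Next Top))
  | rule_Bot x :
      rule U (x ~~> Bot)
        (Always (Start ==>> Neg (Var x))
         :/\: Always (Top ==>> Next (Neg (Var x)))).

Inductive step (U : seq psym) : formula -> formula -> Prop :=
  | step_rule F G : rule U F G -> step U F G
  | step_Andl F F' G : step U F F' -> step U (And F G) (And F' G)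
  | step_Andr F G G' : step U G G' -> step U (And F G) (And F G').

(* Rewriting of one conjunct of F, with new symbols not occurring in F. *)
Definition rewrites (F G : formula) : Prop := step (syms F) F G.

(* [tau0 A F]: F is a final result of the translation of A; it depends on the
   choices of new symbols and of rules. *)
Definition tau0 (A F : formula) : Prop :=
  exists y, [/\ fresh (syms A) [:: y],
    clos_refl_trans formula rewrites
      (Always (Start ==>> Var y) :/\: (y ~~> A)) F &
    clausal F].

(* Main.v *)
(* The conjuncts produced by a rule imply the one it replaces, in the same
   model.  In the other direction, each new symbol [y] names a formula [C] over
   the old symbols ([Next (Unless l m)] for the [y] of the rules for
   [Until l m] and [Unless l m]).  The model is changed at [y] only, so that [y]
   holds exactly where [C] does; the old formula stays true, and in the changed
   model the new conjuncts follow from the equivalence of [y] and [C].  For the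
   existence of a result, structural induction on [A] treats [x ~~> A] and
   [x ~~> Neg A] together. *)

Require Import Defs.
From Stdlib Require Import Classical.

Set Implicit Arguments.
Unset Strict Implicit.
Unset Printing Implicit Defensive.

Local Open Scope pltl_scope.

(** * Semantics *)

(** Classical least-number principle: if no witness were minimal, strong induction would refute
    every witness. *)
Lemma ex_least (P : nat -> Prop) :
  (exists k, P k) -> exists2 k, P k & forall j, j < k -> ~ P j.
Proof.
case=> k Pk; apply: NNPP => nP; elim/ltn_ind: k Pk => k IHk Pk.
by apply: nP; exists k.
Qed.

(** Both the model and the arguments may vary, so that the same congruence serves to compare two
    models on one formula and to replace a subformula by its name within one model. *)
Lemma Until_iff s s' A A' B B' :
    (forall i, holds s i A <-> holds s' i A') ->
    (forall i, holds s i B <-> holds s' i B') ->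
  forall i, holds s i (Until A B) <-> holds s' i (Until A' B').
Proof.
move=> EA EB i; split=> -[k [ik /EB Bk Aj]];
  by exists k; split=> // j /Aj /EA.
Qed.

Lemma Unless_iff s s' A A' B B' :
    (forall i, holds s i A <-> holds s' i A') ->
    (forall i, holds s i B <-> holds s' i B') ->
  forall i, holds s i (Unless A B) <-> holds s' i (Unless A' B').
Proof.
move=> EA EB i; have U := Until_iff EA EB i.
by split=> -[/U|Al]; [left|right=> j /Al /EA|left|right=> j /Al /EA].
Qed.

Definition agree (U : seq psym) (s s' : model) : Prop :=
  forall p, p \in U -> forall i, s i p <-> s' i p.

Lemma agree_holds U s s' A :
  agree U s s' -> {subset syms A <= U} ->
  forall i, holds s i A <-> holds s' i A.
Proof.
move=> ss'.
have sub2 (S T : seq psym) : {subset S ++ T <= U} ->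
    {subset S <= U} /\ {subset T <= U}.
  by move=> ST; split=> p pS; apply: ST; rewrite mem_cat pS ?orbT.
elim: A => [p||||A IHA|A IHA B IHB|A IHA B IHB|A IHA B IHB|A IHA|A IHA|A IHA
  |A IHA B IHB|A IHA B IHB] //= sU;
  try (case/sub2: sU => /IHA EA /IHB EB); try (have EA := IHA sU); move=> i.
- by apply: ss'; apply: sU; rewrite mem_head.
- by have := EA i; tauto.
- by have := EA i; have := EB i; tauto.
- by have := EA i; have := EB i; tauto.
- by have := EA i; have := EB i; tauto.
- exact: EA.
- by split=> -[k ik /EA Ak]; exists k.
- by split=> Al j /Al /EA.
- exact: (Until_iff EA EB).
- exact: (Unless_iff EA EB).
Qed.

Lemma agree_trans U s1 s2 s3 : agree U s1 s2 -> agree U s2 s3 -> agree U s1 s3.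
Proof.
by move=> s12 s23 p pU i; have := s12 p pU i; have := s23 p pU i; tauto.
Qed.

Lemma agree_sub U V s s' : {subset U <= V} -> agree V s s' -> agree U s s'.
Proof. by move=> UV ss' p /UV; apply: ss'. Qed.

(** The value of [y] is set to that of [C] in the old model [s]. As [y] does not occur in [C], this
    change leaves [C] untouched, so the equivalence also holds with [C] read in the new model. *)
Lemma exists_name U s y C : y \notin U -> {subset syms C <= U} ->
  exists2 s', agree U s s' & forall i, s' i y <-> holds s' i C.
Proof.
move=> yU CU; pose s' i p := if p == y then holds s i C else s i p.
have ss' : agree U s s'.
  by move=> p pU i; rewrite /s'; case: eqP => // py; rewrite -py pU in yU.
exists s' => // i; have s'y : s' i y <-> holds s i C by rewrite /s' eqxx.
by have := agree_holds ss' CU i; tauto.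
Qed.

Lemma neg_simp_holds A A' : neg_simp A A' ->
  forall s i, holds s i A <-> holds s i A'.
Proof.
elim=> {A A'} /=; try (move=> A A' B _ IH s i; have := IH s i; tauto);
  try (move=> A A' _ IH s i; have := IH s i; tauto).
- by move=> s i; split=> // nT; apply: nT.
- by move=> s i; split=> // _ [].
- by move=> A s i; split=> [/NNPP|Ai nA]; last exact: nA.
- by move=> A A' _ IH s i; apply: IH.
- by move=> A A' _ IH s i; split=> -[k ik /IH Ak]; exists k.
- by move=> A A' _ IH s i; split=> Al j /Al /IH.
- by move=> A A' B _ IH s; apply: Until_iff => //; apply: IH.
- by move=> A B B' _ IH s; apply: Until_iff => //; apply: IH.
- by move=> A A' B _ IH s; apply: Unless_iff => //; apply: IH.
- by move=> A B B' _ IH s; apply: Unless_iff => //; apply: IH.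
Qed.

Lemma or_ac_holds A A' : or_ac A A' ->
  forall s i, holds s i A <-> holds s i A'.
Proof.
elim=> {A A'} /=.
- by [].
- by move=> A B _ IH s i; have := IH s i; tauto.
- by move=> A B C _ IH1 _ IH2 s i; have := IH1 s i; have := IH2 s i; tauto.
- by move=> *; tauto.
- by move=> *; tauto.
- by move=> A A' B B' _ IH1 _ IH2 s i; have := IH1 s i; have := IH2 s i; tauto.
Qed.

Lemma or_ac_syms A A' : or_ac A A' -> syms A =i syms A'.
Proof.
elim=> {A A'} //=.
- by move=> A B _ IH p; rewrite IH.
- by move=> A B C _ IH1 _ IH2 p; rewrite IH1 IH2.
- by move=> A B p; rewrite !mem_cat orbC.
- by move=> A B C p; rewrite !mem_cat orbA.
- by move=> A A' B B' _ IH1 _ IH2 p; rewrite !mem_cat IH1 IH2.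
Qed.

(** * Laws of until and unless *)

(** An until fails either because [B] never comes, or because [A] already fails at a point up to
    which, inclusively, [B] has not held. The second argument on the right is this point of
    failure. *)
Lemma not_Until s i A B :
  ~ holds s i (Until A B) <->
  holds s i (Unless (Neg B) (And (Neg B) (Neg A))).
Proof.
split=> [nU|[[k [ik [nBk nAk] nB]]|nB] [k' [ik' Bk' A']]]; last first.
- exact: nB ik' Bk'.
- case: (ltngtP k k') => [kk'|k'k|kk'].
  + by apply: nAk; apply: A'; rewrite ik kk'.
  + by case: (nB k' _) => //; rewrite ik' k'k.
  + by rewrite -kk' in Bk'.
- case: (classic (exists k, i <= k /\ holds s k B)) => [|nB]; last first.
    by right=> j ij Bj; apply: nB; exists j.
  (* At the first [k] with [B], the until could fail only through some [j] before [k] without [A];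
     [B] fails up to [j], so [j] is the required witness. *)
  case/ex_least=> k [ik Bk] nBj; left; apply: NNPP => nW; apply: nU.
  exists k; split=> // j /andP[ij jk]; apply: NNPP => nAj; apply: nW.
  have nB h : i <= h < k -> ~ holds s h B.
    by case/andP=> ih hk Bh; apply: (nBj h hk).
  exists j; split=> //; first by split=> //; apply: nB; rewrite ij.
  by move=> h /andP[ih hj]; apply: nB; rewrite ih (ltn_trans hj).
Qed.

(** A failing unless is in particular a failing until, so [not_Until] applies. In its branch where
    [B] never holds, [A] must still fail somewhere, since [Always A] is excluded too; this turns the
    weak operator into the strong one. *)
Lemma not_Unless s i A B :
  ~ holds s i (Unless A B) <->
  holds s i (Until (Neg B) (And (Neg B) (Neg A))).
Proof.
split=> [nW|U [|Al]].
- have nU : ~ holds s i (Until A B) by move=> U; apply: nW; left.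
  case/not_Until: (nU) => // nB; have /ex_least : exists k, i <= k /\ ~ holds s k A.
    apply: NNPP => nA; apply: nW; right=> j ij; apply: NNPP => nAj.
    by apply: nA; exists j.
  case=> k [ik nAk] _; exists k; split=> //; first by split=> //; apply: nB.
  by move=> j /andP[ij _]; apply: nB.
- by apply/not_Until; left.
- by case: U => k [ik [_ nAk] _]; apply: nAk; apply: Al.
Qed.

Lemma Until_Unless s i A B :
  holds s i (Until A B) <-> holds s i (Unless A B) /\ holds s i (Sometime B).
Proof.
split=> [U|[[//|Al] [k0 ik0 Bk0]]].
  by split; [left | case: U => k [ik Bk _]; exists k].
by exists k0; split=> // j /andP[ij _]; apply: Al.
Qed.

(** Unless is a fixpoint of one-step unfolding. This is what lets a new symbol standing for
    [Next (Unless A B)] carry the obligation from one index to the next. *)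
Lemma Unless_unfold s i A B :
  holds s i (Unless A B) <->
  holds s i B \/ holds s i A /\ holds s i.+1 (Unless A B).
Proof.
split=> [[[k [ik Bk Aj]]|Al]|[Bi|[Ai [[k [ik Bk Aj]]|Al]]]].
- move: ik; rewrite leq_eqVlt => /orP[/eqP->|ik]; first by left.
  right; split; first by apply: Aj; rewrite leqnn.
  by left; exists k; split=> // j /andP[/ltnW ij jk]; apply: Aj; rewrite ij.
- by right; split; [apply: Al | right=> j /ltnW /Al].
- by left; exists i; split=> // j; case: (ltngtP i j) => //= ->; rewrite ltnn.
- left; exists k; split=> //; first exact: ltnW.
  move=> j /andP[]; rewrite leq_eqVlt => /orP[/eqP<- //|ij jk].
  by apply: Aj; rewrite ij.
- by right=> j; rewrite leq_eqVlt => /orP[/eqP<- //|/Al].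
Qed.

(** Unless is the greatest fixpoint of its unfolding: an invariant [P] that each step either
    discharges by [B] or passes on together with [A] lies below it. If [B] never holds after [i],
    then [P] and [A] propagate forever; otherwise they propagate up to the first [B]. *)
Lemma Unless_coind s (P : nat -> Prop) A B :
    (forall i, P i -> holds s i B \/ holds s i A /\ P i.+1) ->
  forall i, P i -> holds s i (Unless A B).
Proof.
move=> Pstep i Pi; case: (classic (exists k, i <= k /\ holds s k B)); last first.
  move=> nB; have inv j : i <= j -> holds s j A /\ P j.
    move=> ij; rewrite -(subnKC ij); elim: (j - i) => [|n [_ IHn]].
      rewrite addn0; case: (Pstep i Pi) => [Bi|[]//].
      by case: nB; exists i.
    have nBj k : ~ holds s (i + k) B.
      by move=> Bk; apply: nB; exists (i + k); rewrite leq_addr.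
    have Pn : P (i + n.+1).
      by rewrite addnS; case: (Pstep _ IHn) => [/nBj|[]].
    by case: (Pstep _ Pn) => [/nBj|[]].
  by right=> j /inv[].
case/ex_least=> k [ik Bk] nB; left; exists k; split=> // j jk.
(* The induction must carry [P] along with [A]; it stays strictly before [k], where minimality rules
   out [B]. *)
suff [] : holds s j A /\ P j by [].
case/andP: jk => ij; rewrite -(subnKC ij).
elim: (j - i) => [|n IHn] nk.
  rewrite addn0 in nk *; case: (Pstep i Pi) => [Bi|[]//].
  by case: (nB i nk).
have [_ Pn] : holds s (i + n) A /\ P (i + n).
  by apply: IHn; apply: leq_ltn_trans nk; rewrite leq_add2l.
have nBj h : h < k -> i <= h -> ~ holds s h B.
  by move=> hk ih Bh; apply: (nB h hk).
have {}Pn : P (i + n.+1).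
  rewrite addnS; case: (Pstep _ Pn) => [/nBj|[]//].
  by case; rewrite ?leq_addr // (leq_trans _ nk) // ltnS leq_add2l.
by case: (Pstep _ Pn) => [/nBj|[]//]; case; rewrite ?leq_addr.
Qed.

(** * Soundness *)

Lemma rule_reflects U F G s : rule U F G -> holds s 0 G -> holds s 0 F.
Proof.
case=> {F G}.
- by move=> x A A' /neg_simp_holds E /= H i _ xi; apply/E; apply: H.
- by move=> x A B /= [HA HB] i ii xi; split; [apply: HA | apply: HB].
- by move=> x A B /= H i ii xi; case: (H i ii xi).
- by move=> x A B /= H i ii xi; have := H i ii xi; tauto.
- by move=> x A B /= [H1 H2] i ii xi; have := H1 i ii xi; have := H2 i ii xi; tauto.
- by move=> x A B /= [H1 H2] i ii xi; have := H1 i ii xi; have := H2 i ii xi; tauto.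
- by move=> x A y _ _ /= [H1 H2] i ii xi; apply: H2 => //; apply: H1.
- by move=> x A y _ /= [H1 H2] i ii xi; apply: H2 => //; apply: H1.
- by move=> x A y _ _ /= [H1 H2] i ii xi j ij; apply: H2 => //; apply: (H1 i).
- move=> x A y _ /= [H1 H2] i ii xi Al; have [k ik yk] := H1 i ii xi.
  by apply: (H2 k) => //; apply: Al.
- move=> x A y _ _ /= [H1 H2] i ii xi; have [k ik yk] := H1 i ii xi.
  by exists k => //; apply: H2.
- move=> x A y _ /= [H1 H2] i ii xi [k ik Ak].
  by apply: (H2 k) => //; apply: (H1 i).
- move=> x A B y _ _ /= [H1 H2] i ii xi; have [k [ik Bk yj]] := H1 i ii xi.
  by exists k; split=> // j /yj; apply: H2.
- move=> x A B y _ _ /= [H1 H2] i ii xi; have [k [ik yk Aj]] := H1 i ii xi.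
  by exists k; split=> //; apply: H2.
- move=> x A B y _ _ /= [H1 H2] i ii xi.
  have [[k [ik Bk yj]]|yj] := H1 i ii xi; last by right=> j /yj; apply: H2.
  by left; exists k; split=> // j /yj; apply: H2.
- move=> x A B y _ _ /= [H1 H2] i ii xi.
  have [[k [ik yk Aj]]|Aj] := H1 i ii xi; last by right.
  by left; exists k; split=> //; apply: H2.
- move=> x A B y z v _ [H1 [H2 [H3 H4]]] i ii xi; apply/not_Until.
  have [[k [ik vk yj]]|yj] := H1 i ii xi; last by right=> j /yj; apply: H2.
  left; exists k; split=> //; last by move=> j /yj; apply: H2.
  by case: (H3 k isT vk) => yk zk; split; [apply: H2 | apply: H4].
- move=> x A B y z v _ [H1 [H2 [H3 H4]]] i ii xi; apply/not_Unless.
  have [k [ik vk yj]] := H1 i ii xi.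
  exists k; split=> //; last by move=> j /yj; apply: H2.
  by case: (H3 k isT vk) => yk zk; split; [apply: H2 | apply: H4].
- move=> x l y _ _ /= [H1 [H2 [H3 H4]]] i _ xi j ij.
  (* The symbol [y] propagates itself and forces [l] at each following index; index [i] itself is
     covered by the two conjuncts on [x]. *)
  suff [] : holds s j l /\ s j y by [].
  rewrite -(subnKC ij); elim: (j - i) => [|n [_ IHn]]; rewrite ?addn0.
    by split; [apply: H1 | apply: H2].
  by rewrite addnS; split; [apply: H3 | apply: H4].
- move=> x l m y _ _ _ [H1 [H2 [H3 [H4 H5]]]] i ii xi; apply/Until_Unless.
  split; last exact: H1.
  (* The invariant is the pair of disjunctions themselves: where [m] fails, both [l] and [y] hold,
     and the two [Next] conjuncts of [y] restore the pair at the next index. *)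
  pose P j := holds s j (l :\/: m) /\ holds s j (Var y :\/: m).
  apply: (@Unless_coind s P); last by split; [apply: H2 | apply: H3].
  move=> j [/= [lj|mj]]; last by left.
  case=> [yj|mj]; last by left.
  by right; split=> //; split; [apply: H4 | apply: H5].
- move=> x l m y _ _ _ [H2 [H3 [H4 H5]]] i ii xi.
  pose P j := holds s j (l :\/: m) /\ holds s j (Var y :\/: m).
  apply: (@Unless_coind s P); last by split; [apply: H2 | apply: H3].
  move=> j [/= [lj|mj]]; last by left.
  case=> [yj|mj]; last by left.
  by right; split=> //; split; [apply: H4 | apply: H5].
- move=> x W D A y /or_ac_holds E _ _ [H1 H2] i ii xi; apply/E.
  by case: (H1 i ii xi) => [Di|yi]; [left | right; apply: H2].
(* The [Start] clause covers index 0, and the [Next] clause, used at [i], covers [i.+1]. *)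
- move=> x D _ /= [H1 H2] [|i] _ xi; first by case: (H1 0 isT).
  by case: (H2 i isT).
- by [].
- move=> x /= [H1 H2] [|i] _ xi; first by case: (H1 0 isT).
  by case: (H2 i isT).
Qed.

Lemma fresh1 U y : fresh U [:: y] = (y \notin U).
Proof. by rewrite /fresh /= andbT. Qed.

(** Agreement is claimed on all of [U], not only on the symbols of [F], so that the other conjuncts
    of a larger formula survive the change of model. *)
Lemma rule_preserves U F G s :
    rule U F G -> {subset syms F <= U} -> holds s 0 F ->
  exists2 s', agree U s s' & holds s' 0 G.
Proof.
move=> FG FU sF; have sF' s' : agree U s s' -> holds s' 0 F.
  by move=> ss'; apply/(agree_holds ss' FU).
have same : holds s 0 G -> exists2 s', agree U s s' & holds s' 0 G.
  by exists s.
have name y C : fresh U [:: y] -> {subset syms C <= syms F} ->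
    (forall s', (forall i, holds s' i (Var y) <-> holds s' i C) ->
       holds s' 0 F -> holds s' 0 G) ->
  exists2 s', agree U s s' & holds s' 0 G.
  rewrite fresh1 => yU CF FG'.
  have [s' ss' Ey] := exists_name s yU (fun p pC => FU p (CF p pC)).
  by exists s' => //; apply: FG' => //; apply: sF'.
(* The names are given one after another: [y] for [Neg B], [z] for [Neg A], then [v] for the
   conjunction of the symbols [y] and [z]. The set of protected symbols grows by one each time. *)
have name3 A B y z v : fresh U [:: y; z; v] ->
    {subset syms A ++ syms B <= syms F} ->
    (forall s', (forall i, holds s' i (Var y) <-> holds s' i (Neg B)) ->
       (forall i, holds s' i (Var z) <-> holds s' i (Neg A)) ->
       (forall i, holds s' i (Var v) <-> holds s' i (And (Var y) (Var z))) ->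
       holds s' 0 F -> holds s' 0 G) ->
  exists2 s', agree U s s' & holds s' 0 G.
  rewrite /fresh /= !inE !negb_or !andbT -!andbA.
  case/and5P=> yz yv zv yU /andP[zU vU] ABF FG'.
  have AU : {subset syms A <= U}.
    by move=> p pA; apply: FU; apply: ABF; rewrite mem_cat pA.
  have BU : {subset syms B <= U}.
    by move=> p pB; apply: FU; apply: ABF; rewrite mem_cat pB orbT.
  have U1 : {subset U <= y :: U} by move=> p pU; rewrite inE pU orbT.
  have U2 : {subset y :: U <= z :: y :: U}.
    by move=> p pU; rewrite inE pU orbT.
  have [s1 ss1 Ey] := exists_name (C := Neg B) s yU BU.
  have [|p /AU /U1 //|s2 s12 Ez] := exists_name (U := y :: U) (y := z)
    (C := Neg A) s1.
    by rewrite inE negb_or eq_sym yz.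
  have [||s3 s23 Ev] := exists_name (U := z :: y :: U) (y := v)
    (C := And (Var y) (Var z)) s2.
  - by rewrite !inE !negb_or eq_sym zv eq_sym yv.
  - by move=> p; rewrite !inE => /orP[] ->; rewrite ?orbT.
  (* Later changes keep [y] and [U] fixed, so the equivalence of [y] with [Neg B], obtained in [s1],
     passes to [s3]. *)
  have s13 : agree (y :: U) s1 s3 by apply: agree_trans s12 (agree_sub U2 s23).
  exists s3.
    exact: agree_trans ss1 (agree_sub U1 s13).
  apply: FG' => //.
  + move=> i; have := s13 y (mem_head _ _) i.
    have := agree_holds (A := Neg B) s13 (fun p pB => U1 p (BU p pB)) i.
    by have := Ey i => /=; tauto.
  + move=> i; have := s23 z (mem_head _ _) i.
    have := agree_holds (A := Neg A) s23 (fun p pA => U2 p (U1 p (AU p pA))) i.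
    by have := Ez i => /=; tauto.
  + by apply: sF'; apply: agree_trans ss1 (agree_sub U1 s13).
(* These inclusions settle the side conditions of [name] and [name3], for left-hand sides [x ~~> W]
   with one or two arguments in [W]. *)
have subx (S : seq psym) x : {subset S <= x :: S}.
  by move=> p pS; rewrite inE pS orbT.
have subl (S T : seq psym) x : {subset S <= x :: S ++ T}.
  by move=> p pS; rewrite inE mem_cat pS orbT.
have subr (S T : seq psym) x : {subset T <= x :: S ++ T}.
  by move=> p pT; rewrite inE mem_cat pT !orbT.
case: {F} FG FU sF sF' same name name3 => /=.
- move=> x A A' /neg_simp_holds E _ sF _ + _ _; apply=> i ii xi.
  by apply/E; apply: sF.
- by move=> x A B _ sF _ + _ _; apply; split=> i ii /(sF i ii)[].
- move=> x A B _ sF _ + _ _; apply=> i ii xi; have := sF i ii xi.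
  by have := classic (holds s i A); tauto.
- move=> x A B _ sF _ + _ _; apply=> i ii xi; have := sF i ii xi.
  by have := classic (holds s i A); tauto.
- move=> x A B _ sF _ + _ _; apply; split=> i ii xi; have := sF i ii xi.
    by have := classic (holds s i A); tauto.
  by tauto.
- by move=> x A B _ sF _ + _ _; apply; split=> i ii xi; have := sF i ii xi; tauto.
- move=> x A y yU _ _ _ _ _ + _; move/(_ y A); apply=> // s' Ey sF.
  by split=> i ii; [move/(sF i ii)/Ey | move/Ey].
- move=> x A y yU _ _ _ _ + _; move/(_ y (Neg A)); apply=> // s' Ey sF.
  by split=> i ii; [move/(sF i ii)/Ey | move/Ey].
- move=> x A y yU _ _ _ _ _ + _; move/(_ y A); apply=> // s' Ey sF.
  by split=> i ii; [move/(sF i ii)=> Al j /Al/Ey | move/Ey].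
- move=> x A y yU _ _ _ _ + _; move/(_ y (Neg A)); apply=> // s' Ey sF.
  split=> i ii; [move/(sF i ii)=> nAl | by move/Ey].
  apply: NNPP => nS; apply: nAl => j ij; apply: NNPP => nA; apply: nS.
  by exists j => //; apply/Ey.
- move=> x A y yU _ _ _ _ _ + _; move/(_ y A); apply=> // s' Ey sF.
  by split=> i ii; [move/(sF i ii)=> [k ik /Ey Ak]; exists k | move/Ey].
- move=> x A y yU _ _ _ _ + _; move/(_ y (Neg A)); apply=> // s' Ey sF.
  split=> i ii; [move/(sF i ii)=> nS j ij | by move/Ey].
  by apply/Ey=> Aj; apply: nS; exists j.
- move=> x A B y yU _ _ _ _ _ + _; move/(_ y A); apply=> // s' Ey sF.
  split=> i ii; last by move/Ey.
  by move/(sF i ii)/(@Until_iff s' s' (Var y) A B B Ey (fun=> iff_refl _)).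
- move=> x A B y yU _ _ _ _ _ + _; move/(_ y B); apply=> // s' Ey sF.
  split=> i ii; last by move/Ey.
  by move/(sF i ii)/(@Until_iff s' s' A A (Var y) B (fun=> iff_refl _) Ey).
- move=> x A B y yU _ _ _ _ _ + _; move/(_ y A); apply=> // s' Ey sF.
  split=> i ii; last by move/Ey.
  by move/(sF i ii)/(@Unless_iff s' s' (Var y) A B B Ey (fun=> iff_refl _)).
- move=> x A B y yU _ _ _ _ _ + _; move/(_ y B); apply=> // s' Ey sF.
  split=> i ii; last by move/Ey.
  by move/(sF i ii)/(@Unless_iff s' s' A A (Var y) B (fun=> iff_refl _) Ey).
- move=> x A B y z v yzv _ _ _ _ _; move/(_ A B y z v yzv); apply=> //.
  (* With [y] and [z] unfolded, [v] is exactly the second argument produced by [not_Until]. *)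
  move=> s' Ey Ez Ev sF; have Ev' i : holds s' i (Var v) <->
      holds s' i (And (Neg B) (Neg A)).
    by have := Ev i; have := Ey i; have := Ez i => /=; tauto.
  split; last by split; [|split]=> i _; [move/Ey|move/Ev|move/Ez].
  by move=> i ii /(sF i ii)/not_Until
    /(@Unless_iff s' s' (Var y) (Neg B) (Var v) _ Ey Ev').
- move=> x A B y z v yzv _ _ _ _ _; move/(_ A B y z v yzv); apply=> //.
  move=> s' Ey Ez Ev sF; have Ev' i : holds s' i (Var v) <->
      holds s' i (And (Neg B) (Neg A)).
    by have := Ev i; have := Ey i; have := Ez i => /=; tauto.
  split; last by split; [|split]=> i _; [move/Ey|move/Ev|move/Ez].
  by move=> i ii /(sF i ii)/not_Unless
    /(@Until_iff s' s' (Var y) (Neg B) (Var v) _ Ey Ev').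
(* Here [y] names [Always l] itself, which persists at later indices. *)
- move=> x l y yU _ _ _ _ _ + _; move/(_ y (Always l)); apply=> // s' Ey sF.
  split; first by move=> i ii /(sF i ii); apply.
  split; first by move=> i ii /(sF i ii)/Ey.
  split=> i ii /Ey Al; first exact: Al.
  by apply/Ey=> j /ltnW; apply: Al.
- move=> x l m y yU _ _ _ _ _ _ + _.
  move/(_ y (Next (Unless l m))); apply=> // s' Ey sF.
  (* One unfolding yields both disjunctions. It is applied at the index of [x] and, for the [Next]
     conjuncts, at the successor of an index where [y] holds. *)
  have unf i : holds s' i (Unless l m) ->
      holds s' i (l :\/: m) /\ holds s' i (Var y :\/: m).
    case/Unless_unfold=> [mi|[li Wi]]; first by split; right.
    by split; left=> //; apply/Ey.
  split; first by move=> i ii /(sF i ii)/Until_Unless[].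
  split; first by move=> i ii /(sF i ii)/Until_Unless[/unf[]].
  split; first by move=> i ii /(sF i ii)/Until_Unless[/unf[]].
  by split=> i ii /Ey /unf[].
- move=> x l m y yU _ _ _ _ _ _ + _.
  move/(_ y (Next (Unless l m))); apply=> // s' Ey sF.
  have unf i : holds s' i (Unless l m) ->
      holds s' i (l :\/: m) /\ holds s' i (Var y :\/: m).
    case/Unless_unfold=> [mi|[li Wi]]; first by split; right.
    by split; left=> //; apply/Ey.
  split; first by move=> i ii /(sF i ii)/unf[].
  split; first by move=> i ii /(sF i ii)/unf[].
  by split=> i ii /Ey /unf[].
- move=> x W D A y WDA yU _ _ _ _ _ + _; move/(_ y A); apply=> //.
    (* [A] is a disjunct of [W] only up to rearrangement, so its symbols are located through
       [or_ac_syms]. *)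
    by move=> p pA; rewrite inE (or_ac_syms WDA) mem_cat pA !orbT.
  move=> s' Ey sF; split=> i ii; last by move/Ey.
  move/(sF i ii)/(or_ac_holds WDA)=> [Di|Ai]; first by left.
  by right; apply/Ey.
- move=> x D _ _ sF _ + _ _; apply.
  by split=> i _ _; [have := sF i isT | have := sF i.+1 isT] => /=;
    have := classic (s i x); have := classic (s i.+1 x); tauto.
- by move=> x _ _ _ + _ _; apply.
- move=> x _ sF _ + _ _; apply.
  by split=> i _ _; [apply: (sF i) | apply: (sF i.+1)].
Qed.

Lemma step_reflects U F G s : step U F G -> holds s 0 G -> holds s 0 F.
Proof.
elim=> {F G} [F G /rule_reflects|F F' G _ IH|F G G' _ IH /=]; first exact.
- by case=> /IH.
- by case=> ? /IH.
Qed.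

(** [U] stays fixed during the descent into a conjunct and contains the symbols of the whole
    formula; hence agreement on [U] keeps the sibling conjunct true. *)
Lemma step_preserves U F G s :
    step U F G -> {subset syms F <= U} -> holds s 0 F ->
  exists2 s', agree U s s' & holds s' 0 G.
Proof.
move=> FG; elim: FG s => {F G} [F G FG|F F' G _ IH|F G G' _ IH] s.
- exact: rule_preserves FG.
- move=> FGU [sF sG].
  have [|s' ss' sF'] := IH s _ sF.
    by move=> p pF; apply: FGU; rewrite /= mem_cat pF.
  exists s' => //; split=> //; apply/(agree_holds ss') => // p pG.
  by apply: FGU; rewrite /= mem_cat pG orbT.
- move=> FGU [sF sG].
  have [|s' ss' sG'] := IH s _ sG.
    by move=> p pG; apply: FGU; rewrite /= mem_cat pG orbT.
  exists s' => //; split=> //; apply/(agree_holds ss') => // p pF.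
  by apply: FGU; rewrite /= mem_cat pF.
Qed.

Lemma rewrites_satisfiable F G :
  clos_refl_trans formula rewrites F G -> (satisfiable F <-> satisfiable G).
Proof.
elim=> {F G} [F G FG|//|F G H _ E1 _ E2]; last by rewrite E1.
split=> -[s sF]; last by exists s; apply: step_reflects FG sF.
by have [//|s' _ sG] := step_preserves FG _ sF; exists s'.
Qed.

(** Forward, [y] is made a name of [A]; backward, [y] holds at 0 and so forces [A] there. *)
Lemma satisfiable_start A y : y \notin syms A ->
  satisfiable A <-> satisfiable (Always (Start ==>> Var y) :/\: (y ~~> A)).
Proof.
move=> yA; split=> -[s]; last by case=> sy syA; exists s; apply: syA => //; apply: sy.
move=> sA; have [//|s' ss' Ey] := exists_name s (C := A) yA.
exists s'; split=> i _ /=; last by move/Ey.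
by move=> ->; apply/Ey; apply/(agree_holds ss').
Qed.

(** * Existence of a result *)

Definition rewrites_avoiding (U : seq psym) (F G : formula) : Prop :=
  step (U ++ syms F) F G.

(* Allowing any finite set of symbols to be avoided makes normalizability
   compatible with conjunction. *)
Definition normalizable (F : formula) : Prop :=
  forall U, exists2 G,
    clos_refl_trans formula (rewrites_avoiding U) F G & clausal G.

Lemma fresh_sub U V ys : {subset V <= U} -> fresh U ys -> fresh V ys.
Proof.
move=> VU /andP[uys /allP yU]; rewrite /fresh uys; apply/allP=> y /yU /=.
by apply: contra; apply: VU.
Qed.

Lemma rule_sub U V F G : {subset V <= U} -> rule U F G -> rule V F G.
Proof.
move=> VU; case; try (by constructor); move=> *;
  by constructor => //; apply: fresh_sub VU _.
Qed.

Lemma step_sub U V F G : {subset V <= U} -> step U F G -> step V F G.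
Proof.
move=> VU; elim=> {F G} [F G /(rule_sub VU)|F F' G _|F G G' _].
- exact: step_rule.
- exact: step_Andl.
- exact: step_Andr.
Qed.

Lemma normalizable_clausal F : clausal F -> normalizable F.
Proof. by move=> cF U; exists F => //; apply: rt_refl. Qed.

Lemma normalizable_And F G :
  normalizable F -> normalizable G -> normalizable (And F G).
Proof.
move=> nF nG U.
(* The left conjunct is normalized first, avoiding the symbols of the untouched [G]; the right one
   then has to avoid those of the finished [F'], including the symbols introduced on the way. *)
have [F' FF' cF'] := nF (U ++ syms G); have [G' GG' cG'] := nG (U ++ syms F').
exists (And F' G'); last by rewrite /= cF'.
apply: (@rt_trans _ _ _ (And F' G)).
  elim: FF' => [H K HK|H|H K L _ HK _ KL].
  - apply: rt_step; apply: step_Andl; apply: step_sub HK => p.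
    by rewrite /= !mem_cat -!orbA => /or3P[] ->; rewrite ?orbT.
  - exact: rt_refl.
  - exact: rt_trans HK KL.
elim: GG' => [H K HK|H|H K L _ HK _ KL].
- apply: rt_step; apply: step_Andr; apply: step_sub HK => p.
  by rewrite /= !mem_cat -!orbA.
- exact: rt_refl.
- exact: rt_trans HK KL.
Qed.

Lemma normalizable_rule F :
    (forall U, exists2 G, rule U F G & normalizable G) -> normalizable F.
Proof.
move=> FG U; have [G /step_rule FG' nG] := FG (U ++ syms F).
have [H GH cH] := nG U; exists H => //.
exact: rt_trans (rt_step _ _ _ _ FG') GH.
Qed.

Lemma normalizable_rule0 F G : (forall U, rule U F G) -> normalizable G ->
  normalizable F.
Proof. by move=> FG nG; apply: normalizable_rule => U; exists G. Qed.

Lemma exists_fresh U : exists y, fresh U [:: y].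
Proof.
exists (\max_(p <- U) p).+1; rewrite fresh1; apply/negP=> yU.
by have := @leq_bigmax_seq _ U xpredT id _ yU isT; rewrite ltnn.
Qed.

Lemma exists_fresh3 U : exists y z v, fresh U [:: y; z; v].
Proof.
have [y yU] := exists_fresh U; have [z zU] := exists_fresh (y :: U).
have [v vU] := exists_fresh (z :: y :: U); exists y, z, v.
move: yU zU vU; rewrite !fresh1 /fresh /= !inE !negb_or !andbT.
move=> -> /andP[zy ->] /and3P[vz vy ->].
by rewrite ![_ == v]eq_sym vz vy eq_sym zy.
Qed.

(** The new symbol depends on the set to be avoided, so the result of the rule is a family indexed
    by it. *)
Lemma normalizable_rule1 F G :
    (forall U y, fresh U [:: y] -> rule U F (G y)) ->
    (forall y, normalizable (G y)) -> normalizable F.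
Proof.
move=> FG nG; apply: normalizable_rule => U.
by have [y yU] := exists_fresh U; exists (G y) => //; apply: FG.
Qed.

Lemma normalizable_rule3 F G :
    (forall U y z v, fresh U [:: y; z; v] -> rule U F (G y z v)) ->
    (forall y z v, normalizable (G y z v)) -> normalizable F.
Proof.
move=> FG nG; apply: normalizable_rule => U.
have [y [z [v yzv]]] := exists_fresh3 U.
by exists (G y z v) => //; apply: FG.
Qed.

(** * Translation of each connective *)

(** The left-hand symbol is arbitrary because the rules move subformulas under new symbols. *)
Definition translatable (W : formula) : Prop :=
  forall x, normalizable (x ~~> W).

Lemma literal_lit_disj l : literal l -> lit_disj l.
Proof. by case: l. Qed.

Lemma clausal_lit_disj x D : lit_disj D ->
  clausal (Always (Start ==>> Neg (Var x) :\/: D)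
           :/\: Always (Top ==>> Next (Neg (Var x) :\/: D))).
Proof. by move=> /= ->. Qed.

Lemma translatable_lit_disj D : lit_disj D -> translatable D.
Proof.
move=> lD x; apply: normalizable_rule0 => [U|]; first exact: rule_lit_disj.
exact/normalizable_clausal/clausal_lit_disj.
Qed.

Lemma translatable_literal l : literal l -> translatable l.
Proof. by move/literal_lit_disj/translatable_lit_disj. Qed.

Lemma normalizable_Next x D : lit_disj D -> normalizable (x ~~> Next D).
Proof. by move=> lD; apply: normalizable_clausal; case: D lD. Qed.

Lemma normalizable_Sometime x l : literal l -> normalizable (x ~~> Sometime l).
Proof. by move=> ll; apply: normalizable_clausal; case: l ll. Qed.

Lemma translatable_Or A B :
  translatable A -> translatable B -> translatable (A :\/: B).
Proof.
(* [tOr] renames one disjunct [D] that is not a disjunction of literals, leaving [C] beside a new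
   symbol. At most two renamings are needed: [tOrVar] treats the remaining disjunct, swapped to the
   right, once the other has become a symbol. *)
move=> tA tB; have tOr D : translatable D -> lit_disj D = false ->
    forall W C, or_ac W (C :\/: D) ->
    (forall y, translatable (C :\/: Var y)) -> translatable W.
  move=> tD lD W C WCD tC x.
  apply: (@normalizable_rule1 _ (fun y => (x ~~> C :\/: Var y) :/\: (y ~~> D))).
    by move=> U y yU; apply: (rule_Or x WCD yU); rewrite lD.
  by move=> y; apply: normalizable_And; [apply: tC | apply: tD].
have tOrVar C : translatable C -> forall y, translatable (C :\/: Var y).
  move=> tC y; case lC: (lit_disj C).
    by apply: translatable_lit_disj; rewrite /= lC.
  apply: (tOr C tC lC _ _ (or_acC _ _)) => z.
  exact: translatable_lit_disj.
case lB: (lit_disj B); last first.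
  exact: (tOr B tB lB _ _ (or_ac_refl _) (tOrVar A tA)).
case lA: (lit_disj A); last first.
  exact: (tOr A tA lA _ _ (or_acC _ _) (tOrVar B tB)).
by apply: translatable_lit_disj; rewrite /= lA.
Qed.

Lemma translatable_And A B :
  translatable A -> translatable B -> translatable (And A B).
Proof.
move=> tA tB x; apply: normalizable_rule0 => [U|]; first exact: rule_And.
exact: normalizable_And.
Qed.

Lemma translatable_Always_literal l : literal l -> translatable (Always l).
Proof.
move=> ll x; have dl := literal_lit_disj ll.
apply: normalizable_rule1 => [U y yU|y]; first exact: rule_Always_lit yU _.
by do !apply: normalizable_And;
  [apply: translatable_literal | apply: translatable_literal
  | apply: normalizable_Next | apply: normalizable_Next].
Qed.

Lemma translatable_Always A : translatable A -> translatable (Always A).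
Proof.
move=> tA x; case lA: (literal A); first exact: translatable_Always_literal.
apply: normalizable_rule1 => [U y yU|y].
  by apply: rule_Always yU _; rewrite lA.
by apply: normalizable_And; [apply: translatable_Always_literal | apply: tA].
Qed.

Lemma translatable_Sometime A : translatable A -> translatable (Sometime A).
Proof.
move=> tA x; case lA: (literal A); first exact: normalizable_Sometime.
apply: normalizable_rule1 => [U y yU|y].
  by apply: rule_Sometime yU _; rewrite lA.
by apply: normalizable_And; [apply: normalizable_Sometime | apply: tA].
Qed.

(** Non-literal arguments are renamed, first [A], then [B], until the rule for two literals applies;
    the proof builds these stages in reverse order. *)
Lemma translatable_Until A B :
  translatable A -> translatable B -> translatable (Until A B).
Proof.
have tlit l m : literal l -> literal m -> translatable (Until l m).
  move=> ll lm x; apply: normalizable_rule1 => [U y yU|y].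
    exact: rule_Until_lit yU _ _.
  have [dl dm] := (literal_lit_disj ll, literal_lit_disj lm).
  apply: normalizable_And; first exact: normalizable_Sometime.
  by do !apply: normalizable_And;
    [apply: translatable_lit_disj | apply: translatable_lit_disj
    | apply: normalizable_Next | apply: normalizable_Next]; rewrite /= ?dl.
move=> tA tB; have tl l : literal l -> translatable (Until l B).
  move=> ll x; case lB: (literal B); first exact: tlit.
  apply: normalizable_rule1 => [U y yU|y].
    by apply: rule_Untilr yU _; rewrite lB.
  by apply: normalizable_And; [apply: tlit | apply: tB].
move=> x; case lA: (literal A); first exact: tl.
apply: normalizable_rule1 => [U y yU|y].
  by apply: rule_Untill yU _; rewrite lA.
by apply: normalizable_And; [apply: tl | apply: tA].
Qed.

Lemma translatable_Unless A B :
  translatable A -> translatable B -> translatable (Unless A B).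
Proof.
have tlit l m : literal l -> literal m -> translatable (Unless l m).
  move=> ll lm x; apply: normalizable_rule1 => [U y yU|y].
    exact: rule_Unless_lit yU _ _.
  have [dl dm] := (literal_lit_disj ll, literal_lit_disj lm).
  by do !apply: normalizable_And;
    [apply: translatable_lit_disj | apply: translatable_lit_disj
    | apply: normalizable_Next | apply: normalizable_Next]; rewrite /= ?dl.
move=> tA tB; have tl l : literal l -> translatable (Unless l B).
  move=> ll x; case lB: (literal B); first exact: tlit.
  apply: normalizable_rule1 => [U y yU|y].
    by apply: rule_Unlessr yU _; rewrite lB.
  by apply: normalizable_And; [apply: tlit | apply: tB].
move=> x; case lA: (literal A); first exact: tl.
apply: normalizable_rule1 => [U y yU|y].
  by apply: rule_Unlessl yU _; rewrite lA.
by apply: normalizable_And; [apply: tl | apply: tA].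
Qed.

Lemma translatable_Next A : translatable A -> translatable (Next A).
Proof.
move=> tA x; case lA: (lit_disj A); first exact: normalizable_Next.
apply: normalizable_rule1 => [U y yU|y]; first by apply: rule_Next yU _; rewrite lA.
by apply: normalizable_And; [apply: normalizable_Next | apply: tA].
Qed.

Lemma translatable_Top : translatable Top.
Proof.
move=> x; apply: normalizable_rule0 => [U|]; first exact: rule_Top.
exact: normalizable_clausal.
Qed.

Lemma translatable_Bot : translatable Bot.
Proof.
move=> x; apply: normalizable_rule0 => [U|]; first exact: rule_Bot.
exact: normalizable_clausal.
Qed.

Lemma translatable_neg_simp A A' :
  neg_simp A A' -> translatable A' -> translatable A.
Proof.
move=> AA' tA x; apply: normalizable_rule0 => [U|]; last exact: tA.
exact: rule_simp.
Qed.

(** The negative half is forced by the rules that push a negation onto the arguments, among them the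
    one for a positive [Imp]; the positive half returns through double negation. *)
Lemma pltl_translatable A : pltl A -> translatable A /\ translatable (Neg A).
Proof.
elim: A => [p|||//|A IHA|A IHA B IHB|A IHA B IHB|A IHA B IHB|A IHA|A IHA|A IHA
  |A IHA B IHB|A IHA B IHB] /=;
  try (case/andP=> /IHA[tA tnA] /IHB[tB tnB]); try (move/IHA=> [tA tnA]).
- by split; apply: translatable_literal.
- split; first exact: translatable_Top.
  exact: translatable_neg_simp simp_negT translatable_Bot.
- split; first exact: translatable_Bot.
  exact: translatable_neg_simp simp_negF translatable_Top.
- by split=> //; apply: translatable_neg_simp (simp_negK A) tA.
- split=> [|x]; first exact: translatable_Or.
  apply: normalizable_rule0 => [U|]; first exact: rule_NegOr.
  exact: normalizable_And.
- split=> [|x]; first exact: translatable_And.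
  apply: normalizable_rule0 => [U|]; first exact: rule_NegAnd.
  exact: translatable_Or.
- split=> x.
    apply: normalizable_rule0 => [U|]; first exact: rule_Imp.
    exact: translatable_Or.
  apply: normalizable_rule0 => [U|]; first exact: rule_NegImp.
  exact: normalizable_And.
- split=> [|x]; first exact: translatable_Next.
  apply: normalizable_rule1 => [U y yU|y]; first exact: rule_NegNext yU.
  by apply: normalizable_And; first exact: normalizable_Next.
- split=> [|x]; first exact: translatable_Sometime.
  apply: normalizable_rule1 => [U y yU|y]; first exact: rule_NegSometime yU.
  by apply: normalizable_And; first exact: translatable_Always_literal.
- split=> [|x]; first exact: translatable_Always.
  apply: normalizable_rule1 => [U y yU|y]; first exact: rule_NegAlways yU.
  by apply: normalizable_And; first exact: normalizable_Sometime.
- split=> [|x]; first exact: translatable_Until.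
  apply: normalizable_rule3 => [U y z v yzv|y z v]; first exact: rule_NegUntil yzv.
  apply: normalizable_And; last apply: normalizable_And => //.
    by apply: translatable_Unless; apply: translatable_literal.
  apply: normalizable_And => //.
  by apply: translatable_And; apply: translatable_literal.
- split=> [|x]; first exact: translatable_Unless.
  apply: normalizable_rule3 => [U y z v yzv|y z v]; first exact: rule_NegUnless yzv.
  apply: normalizable_And; last apply: normalizable_And => //.
    by apply: translatable_Until; apply: translatable_literal.
  apply: normalizable_And => //.
  by apply: translatable_And; apply: translatable_literal.
Qed.

(** Since [tau0] is a relation, the existence of a result keeps the equivalence from being vacuous;
    the equivalence itself holds for every choice of rules and new symbols. *)
Theorem theorem3 (A : formula) (hA : pltl A) :
  (exists F : formula, tau0 A F) /\
  (forall F : formula, tau0 A F -> (satisfiable A <-> satisfiable F)).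
Proof.
split=> [|F [y [yA AF _]]].
  have [y yA] := exists_fresh (syms A).
  have nF : normalizable (Always (Start ==>> Var y) :/\: (y ~~> A)).
    apply: normalizable_And; first exact: normalizable_clausal.
    by case: (pltl_translatable hA).
  (* Avoiding the empty set in addition, [rewrites_avoiding] is [rewrites] by computation. *)
  by have [F AF cF] := nF [::]; exists F, y; split.
rewrite -(rewrites_satisfiable AF); apply: satisfiable_start.
by rewrite -fresh1.
Qed.
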